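(* Let $n\ge 1$ be an integer, let $(Y,+)$ be an $(n!)$-divisible Abelian group, let $U:=\mathbb{R}\setminus\{k\pi \mid k\in\mathbb{Z}\}$, and let $X:=(-\infty,0]$ be the semigroup under addition of real numbers. Let $f:U\to Y$ be a function. Then $f$ satisfies $$\sum_{i=0}^{n}(-1)^{n-i}\binom{n}{i} f\left(\arcsin\left|\sin u\,\sin^{i}v\right|\right)=(n!)\,f(v)\quad\text{for all }u,v\in U$$ if and only if there exists an $n$-monomial $\rho\in\mathcal{M}_n(X,Y)$ such that $$f(u)=\rho\left(\ln|\sin u|\right)\quad\text{for all }u\in U.$$
   Context: An Abelian group $(Y,+)$ is called $(n!)$-divisible if the homomorphism $Y\to Y$, $y\mapsto (n!)y$, is an isomorphism (so it is bijective). For a commutative semigroup $(X,+)$, a nonnegative integer $j$, $y\in X$ and $\rho:X\to Y$, put $\Delta_y^{j}\rho(x):=\sum_{i=0}^{j}(-1)^{j-i}\binom{j}{i}\rho(x+iy)$ for $x\in X$ (the term $i=0$ is $\rho(x)$ up to sign). The set $\mathcal{M}_j(X,Y)$ of $j$-monomials consists of all functions $\rho:X\to Y$ with $\Delta_y^{j}\rho(x)=(j!)\rho(y)$ for all $x,y\in X$. Here $\sin^{i}v$ means $(\sin v)^{i}$ (equal to $1$ for $i=0$), and $\arcsin:[-1,1]\to[-\pi/2,\pi/2]$ is the principal branch. *)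

(* Defs.v *)
From HB Require Import structures.
From mathcomp Require Import all_boot all_order all_algebra.
From mathcomp Require Import all_classical all_reals all_analysis.

Set Implicit Arguments.
Unset Strict Implicit.
Unset Printing Implicit Defensive.

Import Order.TTheory GRing.Theory Num.Theory.

Local Open Scope classical_set_scope.
Local Open Scope ring_scope.

(* Unique divisibility: multiplication by [m] is an automorphism, not merely
   surjective. *)
Definition divisible (m : nat) (Y : zmodType) : Prop :=
  bijective (fun y : Y => y *+ m).

(* An [addSemigroupType] is commutative but need not have a zero, so [x + i y]
   is the [i]-fold iterate of [+ y] at [x]. *)
Definition fin_diff (X : addSemigroupType) (Y : zmodType)
    (j : nat) (y : X) (rho : X -> Y) (x : X) : Y :=
  \sum_(0 <= i < j.+1)
    rho (iter i (fun z => z + y) x) *~ ((-1) ^+ (j - i) * 'C(j, i)%:Z).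

Definition monomials (j : nat) (X : addSemigroupType) (Y : zmodType) :
    set (X -> Y) :=
  [set rho | forall x y : X, fin_diff j y rho x = rho y *+ j`!].
Arguments monomials j X Y : clear implicits.

Record nonpos (R : realType) : Type :=
  Nonpos { nonpos_val :> R; _ : nonpos_val <= 0 }.

HB.instance Definition _ (R : realType) := [isSub for @nonpos_val R].
HB.instance Definition _ (R : realType) := [Choice of nonpos R by <:].

Lemma nonpos_closed (R : realType) :
  Algebra.addumagma_closed (fun x : R => x <= 0).
Proof.
split=> [|x y]; rewrite !unfold_in/= ?lexx//.
by move=> x0 y0; rewrite -oppr_ge0 opprD addr_ge0 ?oppr_ge0.
Qed.

HB.instance Definition _ (R : realType) :=
  GRing.SubChoice_isSubNmodule.Build R _ (nonpos R) (@nonpos_closed R).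

Definition non_pi_mult (R : realType) : set R :=
  ~` [set k%:~R * pi | k in [set: int]].
Arguments non_pi_mult : clear implicits.

Lemma sin_int_pi (R : realType) (k : int) (x : R) :
  (sin (x + k%:~R * pi) == 0) = (sin x == 0).
Proof.
have nat_pi (n : nat) (y : R) : (sin (y + n%:R * pi) == 0) = (sin y == 0).
  by rewrite mulr_natl (alternatingn (@sinDpi R)) mulf_eq0 signr_eq0.
case: k => n; first exact: nat_pi.
by rewrite NegzE -(nat_pi n.+1) mulrNz mulNr subrK.
Qed.

Lemma sin_eq0 (R : realType) (u : R) :
  sin u = 0 -> exists k : int, k%:~R * pi = u.
Proof.
move=> su0; set k := Num.floor (u / pi); exists k.
have /andP[] := floor_itv (u / pi); rewrite -/k.
rewrite ler_pdivlMr ?pi_gt0// ltr_pdivrMr ?pi_gt0// intrD mulrDl mul1r => ku uk.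
have := sin_int_pi (- k) u; rewrite su0 eqxx mulrNz mulNr => sr0.
move: ku; rewrite le_eqVlt => /orP[/eqP//|ku].
have : 0 < u - k%:~R * pi < pi by rewrite subr_gt0 ku ltrBlDl.
by move=> /sin_gt0_pi; rewrite lt0r sr0.
Qed.

Lemma sin_neq0 (R : realType) (u : non_pi_mult R) : sin (val u) != 0.
Proof.
apply/eqP => /sin_eq0[k ku].
by have := set_valP u; apply; exists k.
Qed.

Lemma non_pi_mult_asin (R : realType) (u v : non_pi_mult R) (i : nat) :
  asin `|sin (val u) * sin (val v) ^+ i| \in non_pi_mult R.
Proof.
rewrite inE => -[k _ kE].
set x := `|_| in kE.
have xB : -1 <= x <= 1.
  apply/andP; split; first by rewrite (le_trans _ (normr_ge0 _))// lerN10.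
  rewrite /x normrM normrX -[leRHS](mulr1 1).
  have s1 (w : R) : `|sin w| <= 1 by rewrite ler_norml sin_geN1 sin_le1.
  by rewrite ler_pM// exprn_ile1.
have : sin (asin x) != 0.
  by rewrite asinK ?in_itv// normr_eq0 mulf_neq0 ?expf_neq0 ?sin_neq0.
by rewrite -kE -[k%:~R * pi]add0r sin_int_pi sin0 eqxx.
Qed.

Lemma ln_sin_le0 (R : realType) (u : R) : ln `|sin u| <= 0.
Proof. by rewrite ln_le0// ler_norml sin_geN1 sin_le1. Qed.

(* Main.v *)
Require Import Defs.
From mathcomp Require Import all_boot all_order all_algebra.
From mathcomp Require Import all_classical all_reals all_analysis.
Import Order.TTheory GRing.Theory Num.Theory.
Local Open Scope classical_set_scope.
Local Open Scope ring_scope.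

(** The substitution [x = ln |sin u|] turns the trigonometric equation into the
    functional equation of monomials. The map [log_sin : u |-> ln |sin u|] sends
    the admissible angles onto the half-line of nonpositive numbers, and
    [arcsin_exp : x |-> arcsin (exp x)] is a right inverse of it ([arcsin_expK]).
    Logarithms turn the product [sin u * sin^i v] into the sum
    [ln |sin u| + i ln |sin v|], so the [i]-th argument of [f] in the equation is
    [arcsin_exp (log_sin u + i log_sin v)]. Hence the left-hand side is the
    [n]-th difference of [rho := f \o arcsin_exp] at [log_sin u] with step
    [log_sin v] ([sum_arcsin_fin_diff]).

    If [f = r \o log_sin] for a monomial [r], then [rho = r], and the equation is
    the monomial identity for [r]. Conversely, the equation says that the
    difference of [rho] with step [log_sin v] is the constant [n! f(v)]. Choosing
    [v = arcsin_exp y] shows that [rho] is a monomial. Since the difference depends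
    on [v] only through [log_sin v], it also shows [n! f(v) = n! rho(log_sin v)];
    cancelling [n!] gives the representation. *)

Lemma mem_non_pi_mult {R : realType} (u : R) :
  sin u != 0 -> u \in non_pi_mult R.
Proof.
move=> su0; rewrite inE => -[k _ ku]; move: su0.
by rewrite -ku -[_ * pi]add0r sin_int_pi sin0 eqxx.
Qed.

Lemma sin_asin_expR (R : realType) (x : nonpos R) :
  sin (asin (expR x)) = expR x.
Proof.
have x0 : (x : R) <= 0 by case: x.
rewrite asinK// in_itv /=; apply/andP; split; last by rewrite -expR0 ler_expR.
by rewrite (le_trans _ (expR_ge0 _))// lerN10.
Qed.

Lemma asin_expR_mem {R : realType} (x : nonpos R) :
  asin (expR x) \in non_pi_mult R.
Proof. by apply: mem_non_pi_mult; rewrite sin_asin_expR gt_eqF// expR_gt0. Qed.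

Definition log_sin {R : realType} (u : non_pi_mult R) : nonpos R :=
  Nonpos (ln_sin_le0 (val u)).

Definition arcsin_exp {R : realType} (x : nonpos R) : non_pi_mult R :=
  exist _ (asin (expR x)) (asin_expR_mem x).

Lemma arcsin_expK {R : realType} : cancel (@arcsin_exp R) (@log_sin R).
Proof.
move=> x; apply/val_inj => /=.
by rewrite sin_asin_expR gtr0_norm ?expR_gt0// expRK.
Qed.

Lemma val_iter_add (R : realType) (x y : nonpos R) (i : nat) :
  val (iter i (fun z => z + y) x) = val x + val y *+ i.
Proof.
elim: i => [|i IHi]; first by rewrite addr0.
by rewrite iterS [LHS]/= [nonpos_val _]IHi mulrSr addrA.
Qed.

(** The exponential undoes the logarithms: [exp (ln |sin u| + i ln |sin v|)] is
    [|sin u * sin^i v|], because neither sine vanishes. *)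
Lemma arcsin_exp_iter (R : realType) (u v : non_pi_mult R) (i : nat) :
  arcsin_exp (iter i (fun z => z + log_sin v) (log_sin u)) =
  exist _ (asin `|sin (val u) * sin (val v) ^+ i|) (non_pi_mult_asin u v i).
Proof.
have expK (w : non_pi_mult R) : expR (ln `|sin (val w)|) = `|sin (val w)|.
  by rewrite lnK// posrE normr_gt0 sin_neq0.
apply/val_inj => /=; congr asin.
rewrite [nonpos_val _]val_iter_add /= expRD -mulr_natl expRM_natl.
by rewrite !expK normrM normrX.
Qed.

Lemma sum_arcsin_fin_diff (R : realType) (n : nat) (Y : zmodType)
    (f : non_pi_mult R -> Y) (u v : non_pi_mult R) :
  \sum_(0 <= i < n.+1)
    f (exist _ (asin `|sin (val u) * sin (val v) ^+ i|)
         (non_pi_mult_asin u v i))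
      *~ ((-1) ^+ (n - i) * 'C(n, i)%:Z)
  = fin_diff n (log_sin v) (f \o @arcsin_exp R) (log_sin u).
Proof. by apply: eq_bigr => i _; rewrite /= arcsin_exp_iter. Qed.

Theorem theorem4p1 (R : realType) (n : nat) (n_ge1 : (1 <= n)%N)
    (Y : zmodType) (Y_div : divisible n`! Y) (f : non_pi_mult R -> Y) :
  (forall u v : non_pi_mult R,
      \sum_(0 <= i < n.+1)
        f (exist _ (asin `|sin (val u) * sin (val v) ^+ i|)
             (non_pi_mult_asin u v i))
          *~ ((-1) ^+ (n - i) * 'C(n, i)%:Z)
      = f v *+ n`!)
  <->
  (exists rho : nonpos R -> Y,
      monomials n (nonpos R) Y rho /\
      forall u : non_pi_mult R,
        f u = rho (Nonpos (ln_sin_le0 (val u)))).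
Proof.
split=> [feq | [rho [rhoM frho]] u v].
- have diffE (u v : non_pi_mult R) :
      fin_diff n (log_sin v) (f \o @arcsin_exp R) (log_sin u) = f v *+ n`!.
    by rewrite -sum_arcsin_fin_diff feq.
  have monom : monomials n (nonpos R) Y (f \o @arcsin_exp R).
    by move=> x y; rewrite -[x]arcsin_expK -{1}[y]arcsin_expK diffE.
  exists (f \o @arcsin_exp R); split=> // v.
  (* Any base point would do, since the difference is constant; [v] is at hand. *)
  by apply: (bij_inj Y_div); rewrite -(diffE v v) monom.
- rewrite sum_arcsin_fin_diff.
  have -> : f \o @arcsin_exp R = rho.
    by apply/funext => x /=; rewrite frho [Nonpos _]arcsin_expK.
  by rewrite rhoM frho.
Qed.
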